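(* Let $U$ be an $n\times n$ complex unitary matrix such that $\sqrt{n}\,U$ is a complex Hadamard matrix. Then for every integer $r$ with $2\le r\le n-2$, $$\delta_r(U)\ge\frac{n-3}{2n}.$$
   Context: Notation: $[n]=\{1,\dots,n\}$, $N_{n,r}=\binom{n}{r}$, and $U[I,J]$ is the submatrix of $U$ with row set $I$ and column set $J$. A complex Hadamard matrix of order $n$ is an $n\times n$ complex matrix $H=(h_{ij})$ with $|h_{ij}|=1$ for all $i,j$ and $HH^*=nI_n$. For an $n\times n$ unitary matrix $U$ and $1\le r\le n$, the $r$-th uniform-minor discrepancy is $$\delta_r(U)=\sum_{\substack{I,J\subset[n]\\|I|=|J|=r}}\left(|\det U[I,J]|^2-\frac{1}{N_{n,r}}\right)^2.$$ *)

(* Defs.v *)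
From HB Require Import structures.
From mathcomp Require Import all_boot all_order all_algebra.
From mathcomp Require Import complex.
From mathcomp Require Import reals.

Set Implicit Arguments.
Unset Strict Implicit.
Unset Printing Implicit Defensive.

Import Order.TTheory GRing.Theory Num.Theory.

Local Open Scope ring_scope.
Local Open Scope sesquilinear_scope.
Local Open Scope complex_scope.

Section UniformMinorDiscrepancy.
Variables (R : realType) (n : nat).
Implicit Types (H U : 'M[R[i]]_n) (I J : {set 'I_n}).

Definition complex_Hadamard H : Prop :=
  (forall i j, `|H i j| = 1) /\ H *m H^t* = n%:R%:M.

(* U[I,J]; enum_val lists a set of ordinals in increasing order. *)
Definition submatrix U I J : 'M[R[i]]_(#|I|, #|J|) :=
  mxsub (@enum_val _ (mem I)) (@enum_val _ (mem J)) U.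

(* When #|I| = #|J| = r, conform_mx only casts U[I,J] to an r x r matrix;
   the default value 0 is used only for other cardinalities. *)
Definition minor (r : nat) U I J : R[i] :=
  \det (conform_mx (0 : 'M[R[i]]_r) (submatrix U I J)).

(* Normc.normc is the R-valued modulus; `|_| on R[i] takes values in R[i]. *)
Definition minor_discrepancy (r : nat) U : R :=
  \sum_(I : {set 'I_n} | #|I| == r) \sum_(J : {set 'I_n} | #|J| == r)
    (ComplexField.Normc.normc (minor r U I J) ^+ 2 - 'C(n, r)%:R^-1) ^+ 2.

End UniformMinorDiscrepancy.

(* Main.v *)
Require Import Defs.
From mathcomp Require Import all_boot all_order all_algebra.
From mathcomp Require Import complex.
From mathcomp Require Import reals.
From mathcomp Require Import fingroup perm ring lra zify.

(** Write [p(I, J) = |det U[I,J]|^2 - 1/N].  The bound comes from looking only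
at the pair statistics of [p], which are explicit, and bounding the rest below
by zero.

For a fixed column set [J] of size [r], the numbers [|det U[I,J]|^2] are the law of a
determinantal process with kernel [K = U[.,J] U[.,J]^*].  Cauchy-Binet and
Sylvester's determinant identity ([sum_minors_avoiding]) give the probability
that this process avoids both [i] and [j] as
[(1 - K i i)(1 - K j j) - |K i j|^2].  Flatness makes [K i i = r/n], so the
only fluctuating part is [|K i j|^2].

Expanding [|K i j|^2] over pairs of columns in [J] gives, up to an additive
constant and the factor [1/n^2], the sum over [k, l] in [J] of a four-index
tensor [h i j k l] ([pair_tensor]) with vanishing diagonals and row sums both
in [(i, j)] and in [(k, l)]; this is where unitarity enters.  So the same
elementary fact about such harmonic arrays applies on both sides: the lift
[I |-> sum_(i, j in I) a i j] to [r]-sets multiplies the square norm by an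
explicit constant [2 c], with [c = C(n-4, r-2)] ([lift_sum_sqr]).
 - On the row side, Cauchy-Schwarz against the lift bounds the sum over [I] of
   [p(I, J)^2] below by [1/(2c)] times the square norm of the pair statistics
   ([sum_sqr_ge_pairs]).
 - On the column side, summing these square norms over [J] is the norm identity
   itself, and gives back the factor [2 c].

Hence the discrepancy is at least [n^-4] times the square norm of [h].  For each
pair of distinct rows the entrywise product [w = n U_i conj(U_j)] is a unimodular
vector with zero sum, and for such a vector the square norm of [h i j] is at least
[n^2 (n-3) / (2 (n-1))] ([sum_sqr_gram_ge]).  The [n (n-1)] ordered pairs of
distinct rows add up to [(n-3)/(2n)]. *)

Set Implicit Arguments.
Unset Strict Implicit.
Unset Printing Implicit Defensive.

Import Order.TTheory GRing.Theory Num.Theory.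
Local Open Scope ring_scope.

(** * The Cauchy-Binet and Sylvester determinant identities *)

Lemma imset_enum_val (n : nat) (I : {set 'I_n}) :
  (@enum_val _ (mem I)) @: setT = I.
Proof.
apply/setP => x; apply/imsetP/idP => [[k _ ->] | xI]; first exact: enum_valP.
by exists (enum_rank_in xI x); rewrite ?inE // enum_rankK_in.
Qed.

(** The increasing enumeration of [I] has a domain indexed by [#|I|] instead of
[r]; packing its cast as one function [e] lets the later arguments ignore
[conform_mx]. *)
Lemma enum_setP (n r : nat) (I : {set 'I_n}) : #|I| = r ->
  exists e : 'I_r -> 'I_n, [/\ injective e, e @: setT = I,
    (forall (C : pzRingType) m (A : 'M[C]_(m, n)),
      conform_mx (0 : 'M_(m, r)) (colsub (@enum_val _ (mem I)) A) = colsub e A) &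
    (forall (C : pzRingType) m (B : 'M[C]_(n, m)),
      conform_mx (0 : 'M_(r, m)) (rowsub (@enum_val _ (mem I)) B) = rowsub e B)].
Proof.
case: r /; exists (@enum_val _ (mem I)); split; first exact: enum_val_inj.
- exact: imset_enum_val.
- by move=> C m A; rewrite conform_mx_id.
- by move=> C m B; rewrite conform_mx_id.
Qed.

(** One term of Cauchy-Binet: the injective maps with the same image as [e] are
exactly the [e \o s] for a permutation [s], and permuting rows by [s] turns the sum
into the Leibniz formula for the first factor. *)
Lemma sum_injective_onto (C : comPzRingType) (n r : nat) (e : 'I_r -> 'I_n)
    (e_inj : injective e) (A : 'M[C]_(r, n)) (B : 'M[C]_(n, r)) :
  \sum_(f : {ffun 'I_r -> 'I_n} | injectiveb f && (f @: setT == e @: setT))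
     (\prod_i A i (f i)) * \det (rowsub f B) =
  \det (colsub e A) * \det (rowsub e B).
Proof.
pose h (s : 'S_r) := [ffun k => e (s k)].
pose pre (f : {ffun 'I_r -> 'I_n}) : {ffun 'I_r -> 'I_r} :=
  [ffun k => odflt k [pick l | e l == f k]].
(* h' recovers s from e \o s; its default 1 is not reached for maps in the sum. *)
pose h' f : 'S_r := insubd (1%g : 'S_r) (pre f).
have preE (f : {ffun 'I_r -> 'I_n}) :
    f @: setT = e @: setT -> forall k, e (pre f k) = f k.
  move=> fI k; rewrite ffunE; case: pickP => [l /eqP // | none].
  have : f k \in f @: setT by rewrite imset_f.
  by rewrite fI => /imsetP[l _ fkl]; have := none l; rewrite fkl eqxx.
have h_inj s : injectiveb (h s).
  by apply/injectiveP => k1 k2; rewrite !ffunE => /e_inj/perm_inj.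
have h_im s : h s @: setT = e @: setT.
  apply/setP => x; apply/imsetP/imsetP => -[l _ ->].
    by exists (s l); rewrite ?inE // ffunE.
  by exists (s^-1%g l); rewrite ?inE // ffunE permKV.
have pre_inj (f : {ffun 'I_r -> 'I_n}) :
    injective f -> f @: setT = e @: setT -> injectiveb (pre f).
  move=> f_inj fI; apply/injectiveP => k1 k2 /(congr1 e).
  by rewrite !preE // => /f_inj.
rewrite (reindex h) /=; last first.
  exists h' => [s _ | f /andP[/injectiveP f_inj /eqP fI]].
    apply/permP => k; apply: e_inj; rewrite -pvalE /h' insubdK ?preE ?ffunE //.
    by apply: pre_inj => //; apply/injectiveP.
  by apply/ffunP => k; rewrite ffunE -pvalE /h' insubdK ?preE //; exact: pre_inj.
rewrite [X in X * _]/determinant mulr_suml; apply: eq_big => [s | s _].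
  by rewrite h_inj h_im eqxx.
have -> : rowsub (h s) B = row_perm s (rowsub e B).
  by apply/matrixP => i j; rewrite !mxE ffunE.
rewrite row_permE det_mulmx det_perm mulrA [_ * (-1) ^+ s]mulrC.
by congr (_ * _ * _); apply: eq_bigr => i _; rewrite !mxE ffunE.
Qed.

(** Expanding the product over all maps ['I_r -> 'I_n] leaves only the injective
ones, since a repeated row kills the determinant; the others are grouped by
image. *)
Lemma Cauchy_Binet (C : comPzRingType) (n r : nat) (A : 'M[C]_(r, n))
    (B : 'M[C]_(n, r)) :
  \det (A *m B) = \sum_(I : {set 'I_n} | #|I| == r)
    \det (conform_mx (0 : 'M_r) (colsub (@enum_val _ (mem I)) A)) *
    \det (conform_mx (0 : 'M_r) (rowsub (@enum_val _ (mem I)) B)).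
Proof.
transitivity (\sum_(f : {ffun 'I_r -> 'I_n})
    (\prod_i A i (f i)) * \det (rowsub f B)).
  rewrite {1}/determinant.
  transitivity (\sum_(s : 'S_r) \sum_(f : {ffun 'I_r -> 'I_n})
     (-1) ^+ s * \prod_i (A i (f i) * B (f i) (s i))).
    apply: eq_bigr => s _; rewrite -big_distrr /=; congr (_ * _).
    rewrite -(bigA_distr_bigA (fun i k => A i k * B k (s i))).
    by apply: eq_bigr => i _; rewrite mxE.
  rewrite exchange_big; apply: eq_bigr => f _; rewrite big_distrr.
  apply: eq_bigr => s _; rewrite big_split /= mulrCA; congr (_ * (_ * _)).
  by apply: eq_bigr => i _; rewrite mxE.
rewrite (bigID (fun f : {ffun 'I_r -> 'I_n} => injectiveb f)) /=.
rewrite [X in _ + X]big1 ?addr0 => [|f /injectivePn[k1 [k2 nk fk]]]; last first.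
  by rewrite (determinant_alternate nk) ?mulr0 // => j; rewrite !mxE fk.
rewrite (partition_big (fun f : {ffun 'I_r -> 'I_n} => f @: setT)
  (fun I : {set 'I_n} => #|I| == r)) /=; last first.
  by move=> f /injectiveP f_inj; rewrite card_imset // cardsT card_ord.
apply: eq_bigr => I /eqP /enum_setP[e [e_inj <- eC eR]].
by rewrite sum_injective_onto // eC eR.
Qed.

(** Sylvester's identity: both sides are the determinant of the block matrix
[[1, A], [B, 1]] after clearing its lower left block from the right or from the
left. *)
Lemma det_subM_comm (C : comPzRingType) (m p : nat) (A : 'M[C]_(m, p))
    (B : 'M[C]_(p, m)) :
  \det (1%:M - A *m B) = \det (1%:M - B *m A).
Proof.
pose M := block_mx 1%:M A B 1%:M.
have E1 : M *m block_mx 1%:M 0 (- B) 1%:M = block_mx (1%:M - A *m B) A 0 1%:M.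
  rewrite mulmx_block !mul1mx !mulmx0 !mulmx1 mulmxN !add0r.
  by rewrite addrN.
have E2 : block_mx 1%:M 0 (- B) 1%:M *m M = block_mx 1%:M A 0 (1%:M - B *m A).
  rewrite mulmx_block !mul1mx !mul0mx !mulmx1 !addr0 mulNmx.
  by rewrite addNr [- _ + _]addrC.
have := congr1 determinant E2; rewrite det_ublock det1 mul1r => <-.
have := congr1 determinant E1; rewrite det_ublock det1 mulr1 => <-.
by rewrite !det_mulmx mulrC.
Qed.

Lemma det_2x2 (K : comPzRingType) (A : 'M[K]_2) :
  \det A = A 0 0 * A 1 1 - A 0 1 * A 1 0.
Proof.
rewrite (expand_det_row _ ord0) big_ord_recl big_ord1 /cofactor !det_mx11 !mxE /=.
rewrite expr0 expr1 !mul1r mulN1r mulrN.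
by congr (A _ _ * A _ _ - A _ _ * A _ _); apply/val_inj.
Qed.

(** * Harmonic arrays on pairs and their lifts to r-sets *)

Lemma card_supersets (n r : nat) (S : {set 'I_n}) : (r <= n)%N ->
  #|[set I : {set 'I_n} | (S \subset I) && (#|I| == r)]| = 'C(n - #|S|, n - r).
Proof.
move=> rn; have -> : (n - #|S|)%N = #|~: S| by rewrite [RHS]cardsCs setCK card_ord.
rewrite -cards_draws -[LHS](card_imset _ (@setC_inj _)).
apply: eq_card => T; apply/imsetP/idP => [[I] | ].
  rewrite !inE => /andP[SI /eqP <-] ->.
  by rewrite setCS SI cardsCs setCK card_ord eqxx.
rewrite !inE => /andP[TS /eqP hT]; exists (~: T); last by rewrite setCK.
by rewrite inE -setCS setCK TS cardsCs setCK card_ord hT subKn ?eqxx.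
Qed.

Lemma binomial_second_difference (m s : nat) : (4 <= m)%N -> (2 <= s)%N ->
  ('C(m - 2, s) + 'C(m - 4, s) = 'C(m - 4, s - 2) + 2 * 'C(m - 3, s))%N.
Proof.
case: m => [|[|[|[|m]]]] // _; case: s => [|[|s]] // _.
rewrite !subSS !subn0 !binS; lia.
Qed.

Lemma card_quad (T : finType) (i j k l : T) : i != j -> k != l ->
  #|[set i; j; k; l]| = (4 - (i == k) - (i == l) - (j == k) - (j == l))%N.
Proof.
move=> ij kl; rewrite -!setUA !cardsU1 cards1 !inE (negbTE ij) (negbTE kl).
have [ik|ik] := eqVneq i k; have [jk|jk] := eqVneq j k;
have [il|il] := eqVneq i l; have [jl|jl] := eqVneq j l => //=; subst;
by rewrite ?eqxx // in ij kl *.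
Qed.

Section Harmonic.
Variables (R : realFieldType) (n : nat).
Implicit Types (a : 'I_n -> 'I_n -> R) (I : {set 'I_n}) (r : nat).

(** Symmetric arrays on unordered pairs (hence the zero diagonal) with zero row
sums: the degree-two isotypic component of functions on pairs of points. *)
Definition harmonic a :=
  [/\ forall i j, a i j = a j i, forall i, a i i = 0 &
      forall i, \sum_j a i j = 0].

Definition lift_sum a I := \sum_(i in I) \sum_(j in I) a i j.

(** Since [n - 4 = (r - 2) + (n - r - 2)], this is [C(n-4, r-2)]; choosing the
complement avoids a truncated [r - 3] or [r - 4] in the derivation. *)
Definition lift_const r : R := ('C(n - 4, n - r - 2))%:R.

(** Zero row sums let each summation set be exchanged for its complement at the
cost of a sign, and this happens twice.  It lets avoidance probabilities, which
are single determinants, replace inclusion probabilities. *)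
Lemma lift_sum_compl a I : harmonic a ->
  lift_sum a I = \sum_(i in ~: I) \sum_(j in ~: I) a i j.
Proof.
case=> asym _ a0.
have aI i : \sum_(j in ~: I) a i j = - \sum_(j in I) a i j.
  apply/eqP; rewrite -addr_eq0 addrC; apply/eqP; rewrite -[RHS](a0 i).
  rewrite [RHS](bigID (mem I)) /=; congr (_ + _).
  by apply: eq_bigl => j; rewrite inE.
under [RHS]eq_bigr => i _ do rewrite aI.
rewrite sumrN exchange_big /= -sumrN; apply: eq_bigr => j _.
under [X in - X]eq_bigr => i _ do rewrite asym.
by rewrite aI opprK.
Qed.

Lemma sum_supersets r (S : {set 'I_n}) : (r <= n)%N ->
  \sum_(I : {set 'I_n} | #|I| == r) (S \subset I)%:R
    = ('C(n - #|S|, n - r))%:R :> R.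
Proof.
move=> rn; rewrite -card_supersets // -sum1dep_card natr_sum.
rewrite [RHS]big_mkcond [LHS]big_mkcond; apply: eq_bigr => I _.
by case: ifP; case: (S \subset I).
Qed.

Lemma lift_constE r : (2 <= r)%N -> (r <= n - 2)%N ->
  lift_const r = ('C(n - 2, n - r))%:R - 2 * ('C(n - 3, n - r))%:R
                 + ('C(n - 4, n - r))%:R.
Proof.
move=> r2 rn; have := @binomial_second_difference n (n - r).
move=> /(_ ltac:(lia) ltac:(lia)) /(congr1 (fun k => k%:R : R)).
by rewrite natrD natrD natrM /lift_const => H; lra.
Qed.

(** Restricting the lift of [a] back to the pair [{i, j}] multiplies [a] by a
constant.  The number of [r]-sets containing [i, j, k, l] depends only on the
number of coincidences between the two pairs; written as a polynomial in the
Kronecker deltas, its terms of degree below two are killed by the zero row sums,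
and the coefficient of the two full coincidences is a second difference of
binomials. *)
Lemma lift_sum_restrict a r (i j : 'I_n) : harmonic a -> (2 <= r)%N ->
  (r <= n - 2)%N -> i != j ->
  \sum_(I : {set 'I_n} | #|I| == r) ((i \in I) && (j \in I))%:R * lift_sum a I
    = 2 * lift_const r * a i j.
Proof.
case=> asym a00 a0 r2 rn ij.
pose N m : R := ('C(n - m, n - r))%:R.
have quad k l : k != l ->
  \sum_(I : {set 'I_n} | #|I| == r) ([set i; j; k; l] \subset I)%:R
   = N 4 + ((i == k)%:R + (j == k)%:R) * (N 3 - N 4)
         + ((i == l)%:R + (j == l)%:R) * (N 3 - N 4)
         + ((i == k)%:R * (j == l)%:R + (j == k)%:R * (i == l)%:R) * lift_const r.
  move=> kl; rewrite sum_supersets; last by lia.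
  rewrite lift_constE //.
  rewrite card_quad // -/(N _); move: ij kl.
  have [?|ik] := eqVneq i k; have [?|il] := eqVneq i l;
  have [?|jk] := eqVneq j k; have [?|jl] := eqVneq j l; subst => //=;
  rewrite ?eqxx //= => *; rewrite ?subn0 ?subSS; rewrite /N; ring.
have a0' k : \sum_l a l k = 0 by under eq_bigr do rewrite asym; exact: a0.
have row0 (F : 'I_n -> R) : \sum_k \sum_l F k * a k l = 0.
  by apply: big1 => k _; rewrite -mulr_sumr a0 mulr0.
have col0 (F : 'I_n -> R) : \sum_k \sum_l F l * a k l = 0.
  by rewrite exchange_big big1 // => l _; rewrite -mulr_sumr a0' mulr0.
have pick (x y : 'I_n) : \sum_k \sum_l (x == k)%:R * (y == l)%:R * a k l = a x y.
  rewrite (bigD1 x) //= (bigD1 y) //= !eqxx !mul1r !big1 ?addr0 //.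
    by move=> k; rewrite eq_sym => /negbTE-> ; rewrite big1 // => l _; rewrite !mul0r.
  by move=> l; rewrite eq_sym => /negbTE->; rewrite mulr0 mul0r.
transitivity (\sum_k \sum_l
   (\sum_(I : {set 'I_n} | #|I| == r) ([set i; j; k; l] \subset I)%:R) * a k l).
  transitivity (\sum_(I : {set 'I_n} | #|I| == r) \sum_k \sum_l
     ([set i; j; k; l] \subset I)%:R * a k l).
    apply: eq_bigr => I _; rewrite /lift_sum mulr_sumr big_mkcond /=.
    apply: eq_bigr => k _; rewrite mulr_sumr big_mkcond /= .
    case: ifP => kI; last first.
      by rewrite big1 // => l _; rewrite !subUset !sub1set kI andbF mul0r.
    apply: eq_bigr => l _; rewrite !subUset !sub1set kI andbT.
    by case: ifP => lI; rewrite ?andbT ?andbF ?mul0r.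
  rewrite exchange_big; apply: eq_bigr => k _.
  by rewrite exchange_big; apply: eq_bigr => l _; rewrite mulr_suml.
transitivity (\sum_k \sum_l (N 4 * a k l
     + ((i == k)%:R + (j == k)%:R) * (N 3 - N 4) * a k l
     + ((i == l)%:R + (j == l)%:R) * (N 3 - N 4) * a k l
     + lift_const r * ((i == k)%:R * (j == l)%:R * a k l)
     + lift_const r * ((j == k)%:R * (i == l)%:R * a k l))).
  apply: eq_bigr => k _; apply: eq_bigr => l _.
  have [->|kl] := eqVneq k l; first by rewrite a00 !mulr0 !addr0.
  by rewrite quad //; ring.
under eq_bigr do rewrite !big_split /=.
rewrite !big_split /= (row0 (fun=> N 4)).
rewrite (row0 (fun k => ((i == k)%:R + (j == k)%:R) * (N 3 - N 4))).
rewrite (col0 (fun l => ((i == l)%:R + (j == l)%:R) * (N 3 - N 4))).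
under eq_bigr do rewrite -mulr_sumr.
under [X in _ + X]eq_bigr do rewrite -mulr_sumr.
rewrite -!mulr_sumr !pick asym; ring.
Qed.

(** Lifting and restricting are adjoint, so the norm of the lift follows from the
scalar by which their composite acts. *)
Lemma lift_sum_sqr a r : harmonic a -> (2 <= r)%N -> (r <= n - 2)%N ->
  \sum_(I : {set 'I_n} | #|I| == r) lift_sum a I ^+ 2
    = 2 * lift_const r * \sum_i \sum_j a i j ^+ 2.
Proof.
move=> ha r2 rn.
transitivity (\sum_i \sum_j a i j *
  \sum_(I : {set 'I_n} | #|I| == r) ((i \in I) && (j \in I))%:R * lift_sum a I).
  transitivity (\sum_(I : {set 'I_n} | #|I| == r) \sum_i \sum_j
     a i j * (((i \in I) && (j \in I))%:R * lift_sum a I)).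
    apply: eq_bigr => I _; rewrite expr2 {1}/lift_sum mulr_suml big_mkcond /=.
    apply: eq_bigr => i _; case: ifP => iI; last first.
      by rewrite big1 // => j _; rewrite mul0r mulr0.
    rewrite mulr_suml big_mkcond; apply: eq_bigr => j _ /=.
    by case: ifP; rewrite ?mul1r // mul0r mulr0.
  rewrite exchange_big; apply: eq_bigr => i _.
  by rewrite exchange_big; apply: eq_bigr => j _; rewrite mulr_sumr.
rewrite mulr_sumr; apply: eq_bigr => i _; rewrite mulr_sumr; apply: eq_bigr => j _.
have [->|ij] := eqVneq i j; last by rewrite lift_sum_restrict //; ring.
by have [_ -> _] := ha; rewrite mul0r expr0n mulr0.
Qed.

Lemma lift_const_gt0 r : (2 <= r)%N -> (r <= n - 2)%N -> 0 < lift_const r.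
Proof. by move=> r2 rn; rewrite /lift_const ltr0n bin_gt0; lia. Qed.

(** Cauchy-Schwarz of [p] against the lift of [a]: the hypothesis says that the
pair avoidance sums of [p] are [- a] up to a constant [kappa], which is
orthogonal to harmonic arrays. *)
Lemma sum_sqr_ge_pairs (p : {set 'I_n} -> R) a r (kappa : R) : harmonic a ->
  (2 <= r)%N -> (r <= n - 2)%N ->
  (forall i j, i != j ->
    \sum_(I : {set 'I_n} | #|I| == r) ((i \notin I) && (j \notin I))%:R * p I
      = kappa - a i j) ->
  (\sum_i \sum_j a i j ^+ 2) / (2 * lift_const r)
    <= \sum_(I : {set 'I_n} | #|I| == r) p I ^+ 2.
Proof.
move=> ha r2 rn hp; set S := \sum_i _.
have c0 := lift_const_gt0 r2 rn; set c := lift_const r in c0 *.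
have inner : \sum_(I : {set 'I_n} | #|I| == r) p I * lift_sum a I = - S.
  transitivity (\sum_i \sum_j a i j * \sum_(I : {set 'I_n} | #|I| == r)
      ((i \notin I) && (j \notin I))%:R * p I).
    transitivity (\sum_(I : {set 'I_n} | #|I| == r) \sum_i \sum_j
        a i j * (((i \notin I) && (j \notin I))%:R * p I)).
      apply: eq_bigr => I _; rewrite lift_sum_compl // mulr_sumr big_mkcond /=.
      apply: eq_bigr => i _; rewrite inE; case: ifP => iI; last first.
        by rewrite big1 // => j _; rewrite mul0r mulr0.
      rewrite mulr_sumr big_mkcond; apply: eq_bigr => j _ /=; rewrite inE.
      by case: ifP => _ /=; ring.
    rewrite exchange_big; apply: eq_bigr => i _.
    by rewrite exchange_big; apply: eq_bigr => j _; rewrite mulr_sumr.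
  transitivity (\sum_i \sum_j (kappa * a i j - a i j ^+ 2)).
    apply: eq_bigr => i _; apply: eq_bigr => j _.
    have [->|ij] := eqVneq i j; last by rewrite hp //; ring.
    by have [_ -> _] := ha; ring.
  have [_ _ a0] := ha; rewrite -sumrN; apply: eq_bigr => i _.
  by rewrite sumrB -mulr_sumr a0 mulr0 sub0r.
(* The orthogonal projection of p on the lift has coefficient - 1 / (2 c). *)
have : 0 <= \sum_(I : {set 'I_n} | #|I| == r) (p I + lift_sum a I / (2 * c)) ^+ 2.
  by apply: sumr_ge0 => I _; exact: sqr_ge0.
have -> : \sum_(I : {set 'I_n} | #|I| == r) (p I + lift_sum a I / (2 * c)) ^+ 2
  = \sum_(I : {set 'I_n} | #|I| == r) p I ^+ 2
    + c^-1 * (\sum_(I : {set 'I_n} | #|I| == r) p I * lift_sum a I)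
    + (2 * c)^-2 * \sum_(I : {set 'I_n} | #|I| == r) lift_sum a I ^+ 2.
  rewrite !mulr_sumr -!big_split /=; apply: eq_bigr => I _; field; lra.
rewrite inner lift_sum_sqr // -/c -/S -addrA.
have -> : c^-1 * - S + (2 * c) ^- 2 * (2 * c * S) = - (S / (2 * c)) by field; lra.
by rewrite subr_ge0.
Qed.

Lemma sum_avoiding_const r (i j : 'I_n) : i != j ->
  \sum_(I : {set 'I_n} | #|I| == r) ((i \notin I) && (j \notin I))%:R
    = ('C(n - 2, r))%:R :> R.
Proof.
move=> ij; have -> : (n - 2)%N = #|~: [set i; j]|.
  by rewrite [RHS]cardsCs setCK card_ord cards2 ij.
rewrite -cards_draws -sum1dep_card natr_sum.
rewrite [RHS]big_mkcond [LHS]big_mkcond; apply: eq_bigr => I _.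
have -> : (I \subset ~: [set i; j]) = (i \notin I) && (j \notin I).
  by rewrite -setCS setCK subUset !sub1set !inE.
by case: (#|I| == r); case: ((i \notin I) && _).
Qed.
End Harmonic.

(** * Determinantal avoidance probabilities *)

Section FlatUnitary.
Variables (R : realType) (n : nat).
Local Notation C := R[i].
Implicit Types (U : 'M[C]_n) (I J : {set 'I_n}).
Import ComplexField.Normc.

Lemma sqr_normc (z : C) : normc z ^+ 2 = complex.Re (z * z^*).
Proof.
by case: z => x y /=; rewrite sqr_sqrtr ?addr_ge0 ?sqr_ge0 // mulrN opprK -!expr2.
Qed.

Lemma Re_sum (T : Type) (s : seq T) (P : pred T) (F : T -> C) :
  complex.Re (\sum_(i <- s | P i) F i) = \sum_(i <- s | P i) complex.Re (F i).
Proof. by apply: (big_morph (@complex.Re R)) => // -[a b] [c d]. Qed.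

Lemma minor_colsub (r : nat) U J : #|J| = r ->
  exists e : 'I_r -> 'I_n, [/\ injective e, e @: setT = J &
    forall I, minor r U I J =
      \det (conform_mx (0 : 'M_r) (rowsub (@enum_val _ (mem I)) (colsub e U)))].
Proof.
case: r /; exists (@enum_val _ (mem J)); split; first exact: enum_val_inj.
  exact: imset_enum_val.
move=> I; rewrite /minor /submatrix; congr (\det (conform_mx _ _)).
by apply/matrixP => k l; rewrite !mxE.
Qed.

Definition col_kernel U J i j : C := \sum_(k in J) U i k * (U j k)^*.

(** By Cauchy-Binet the left side is the determinant of [U_J^* D U_J], where [D]
erases rows [i] and [j].  As the columns of [U_J] are orthonormal this matrix is
[1 - V^* V], with [V] made of the two erased rows, and Sylvester's identity
reduces it to size two. *)
Lemma sum_minors_avoiding (r : nat) U J (i j : 'I_n) :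
  (forall k l, \sum_i (U i k)^* * U i l = (k == l)%:R) ->
  #|J| = r -> i != j ->
  \sum_(I : {set 'I_n} | #|I| == r)
     ((i \notin I) && (j \notin I))%:R * normc (minor r U I J) ^+ 2
  = complex.Re ((1 - col_kernel U J i i) * (1 - col_kernel U J j j)
                - col_kernel U J i j * col_kernel U J j i).
Proof.
move=> orth hJ ij; have [e [e_inj eJ minorE]] := minor_colsub U hJ.
pose x (b : 'I_2) := if b == 0 then i else j.
pose V : 'M[C]_(2, r) := \matrix_(b, k) U (x b) (e k).
pose V' : 'M[C]_(r, 2) := \matrix_(k, b) (U (x b) (e k))^*.
pose A : 'M[C]_(r, n) :=
  \matrix_(k, l) if (l == i) || (l == j) then 0 else (U l (e k))^*.
pose B := colsub e U.
have VV' b b' : (V *m V') b b' = col_kernel U J (x b) (x b').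
  rewrite /col_kernel mxE -eJ big_imset /=; last by move=> ? ? _ _ /e_inj.
  by apply: eq_big => [k | k _]; rewrite ?inE // !mxE.
have AB : A *m B = 1%:M - V' *m V.
  have V'V k l : (V' *m V) k l
      = (U i (e k))^* * U i (e l) + (U j (e k))^* * U j (e l).
    by rewrite mxE big_ord_recl big_ord1 !mxE.
  apply/matrixP => k l; rewrite [RHS]mxE [X in _ = _ + X]mxE V'V mxE [in RHS]mxE.
  rewrite -(inj_eq e_inj) -orth.
  rewrite (bigD1 i) //= (bigD1 j) 1?eq_sym //= !mxE !eqxx orbT !mul0r !add0r.
  rewrite [in RHS](bigD1 i) //= [in RHS](bigD1 j) 1?eq_sym //=.
  rewrite addrA [X in _ = X]addrAC subrr add0r; apply: eq_bigr => m /andP[mi mj].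
  by rewrite !mxE (negbTE mi) (negbTE mj).
have detAB : \det (A *m B) = (1 - col_kernel U J i i) * (1 - col_kernel U J j j)
                - col_kernel U J i j * col_kernel U J j i.
  rewrite AB det_subM_comm det_2x2.
  have E b b' : (1%:M - V *m V') b b' = (b == b')%:R - col_kernel U J (x b) (x b').
    by rewrite mxE [X in _ + X]mxE VV' mxE.
  by rewrite !E /x /=; ring.
rewrite -detAB Cauchy_Binet Re_sum; apply: eq_bigr => I /eqP hI.
rewrite sqr_normc minorE; have [f [f_inj fI fC fR]] := enum_setP hI.
rewrite fC fR; have [avoid|] := boolP ((i \notin I) && (j \notin I)).
  rewrite mul1r [in RHS]mulrC; congr (complex.Re (_ * _)).
  rewrite -det_tr -det_map_mx; congr (\det _); apply/matrixP => k l; rewrite !mxE.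
  case: ifP => // /orP[] /eqP fl; move: avoid; rewrite -fl -fI imset_f ?inE //.
  by rewrite andbF.
rewrite mul0r -negb_or negbK => /orP meet.
suff -> : \det (colsub f A) = 0 by rewrite mul0r.
have [l fl] : exists l, (f l == i) || (f l == j).
  by case: meet; rewrite -fI => /imsetP[l _ ->]; exists l; rewrite eqxx ?orbT.
rewrite -det_tr (expand_det_row _ l) big1 // => k _; by rewrite !mxE fl mul0r.
Qed.

(** * The tensor of pair correlations *)

(** The inner product, as real vectors of dimension two, of the entries [k] and
[l] of the entrywise product of row [i] and the conjugate of row [j]. *)
Definition gram U (i j k l : 'I_n) : R :=
  complex.Re ((U i k * (U j k)^*) * (U j l * (U i l)^*)).

(** For distinct rows of a flat unitary matrix the off-diagonal mean of
[n^2 gram U i j] is [- 1/(n-1)]; subtracting it makes the tensor harmonic. *)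
Definition pair_tensor U (i j k l : 'I_n) : R :=
  if (i == j) || (k == l) then 0
  else n%:R ^+ 2 * gram U i j k l + (n%:R - 1)^-1.

Lemma gram_tr U i j k l : gram U^T k l i j = gram U i j k l.
Proof. by rewrite /gram !mxE; congr complex.Re; ring. Qed.

Lemma gram_sym U i j k l : gram U i j l k = gram U i j k l.
Proof.
rewrite /gram; case: (U i k) (U i l) (U j k) (U j l) => a b [c d] [e f] [g h] /=.
ring.
Qed.

Lemma pair_tensor_tr U i j k l : pair_tensor U^T k l i j = pair_tensor U i j k l.
Proof. by rewrite /pair_tensor orbC gram_tr. Qed.

(** The vanishing diagonal absorbed into a Kronecker delta, so that sums over
[k] and [l] split without case distinctions. *)
Lemma pair_tensorE U i j k l : (1 < n)%N ->
  (forall i k, U i k * (U i k)^* = n%:R^-1) -> i != j ->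
  pair_tensor U i j k l = n%:R ^+ 2 * gram U i j k l + (n%:R - 1)^-1
     - (k == l)%:R * (n%:R / (n%:R - 1)).
Proof.
move=> n1 flat ij; rewrite /pair_tensor (negbTE ij) /=.
have [<-|kl] := eqVneq k l; last by rewrite mul0r subr0.
have -> : gram U i j k k = (n%:R ^+ 2)^-1.
  rewrite /gram [X in complex.Re X](_ : _ =
    (U i k * (U i k)^*) * (U j k * (U j k)^*)); last by ring.
  rewrite !flat -invfM -natrM; suff -> : (n * n)%:R^-1 = ((n%:R ^+ 2)^-1)%:C%C :> C.
    by [].
  by rewrite fmorphV rmorphXn rmorph_nat natrM expr2.
have n2 : (1 : R) < n%:R by rewrite ltr1n.
by rewrite mul1r; field; apply/andP; split; lra.
Qed.

Lemma pair_tensor_harmonic U i j : (1 < n)%N ->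
  (forall i k, U i k * (U i k)^* = n%:R^-1) ->
  (forall i j, \sum_k U i k * (U j k)^* = (i == j)%:R) ->
  harmonic (pair_tensor U i j).
Proof.
move=> n1 flat orth; split=> [k l | k | k].
- by rewrite /pair_tensor [k == l]eq_sym gram_sym.
- by rewrite /pair_tensor eqxx orbT.
have [<-|ij] := eqVneq i j.
  by apply: big1 => l _; rewrite /pair_tensor eqxx.
under eq_bigr do rewrite pair_tensorE //.
rewrite sumrB big_split /= -mulr_sumr -Re_sum -mulr_sumr orth eq_sym (negbTE ij).
rewrite mulr0 mulr0 add0r sumr_const card_ord.
rewrite (bigD1 k) //= eqxx mul1r big1 ?addr0; last first.
  by move=> l; rewrite eq_sym => /negbTE ->; rewrite mul0r.
by rewrite -[_ *+ n]mulr_natl subrr.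
Qed.

(** With [w k = x k + i y k] unimodular of zero sum, the main term is the square
norm of the Gram matrix of the [w k].  It equals [X^2 + 2 Z^2 + Y^2] for the
second moments [X], [Y], [Z] of the coordinates, and [X + Y = n] bounds it below
by [n^2 / 2]. *)
Lemma sum_sqr_gram_ge (x y : 'I_n -> R) : (1 < n)%N ->
  (forall k, x k ^+ 2 + y k ^+ 2 = 1) -> \sum_k x k = 0 -> \sum_k y k = 0 ->
  n%:R ^+ 2 * (n%:R - 3) / (2 * (n%:R - 1)) <= \sum_k \sum_l
   (x k * x l + y k * y l + (n%:R - 1)^-1 - (k == l)%:R * (n%:R / (n%:R - 1))) ^+ 2.
Proof.
move=> n1 xy sx sy; have n2 : (1 : R) < n%:R by rewrite ltr1n.
set t := (n%:R - 1)^-1; set N : R := n%:R in n2 t *.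
have tE : N * t = 1 + t by rewrite /t; field; lra.
have -> : N ^+ 2 * (N - 3) / (2 * (N - 1)) = N ^+ 2 / 2 - N ^+ 2 * t.
  by rewrite /t; field; lra.
pose X := \sum_k x k ^+ 2; pose Y := \sum_k y k ^+ 2.
pose Z := \sum_k x k * y k.
have XY : X + Y = N.
  rewrite -big_split /=; under eq_bigr do rewrite xy.
  by rewrite sumr_const card_ord.
suff -> : \sum_k \sum_l
     (x k * x l + y k * y l + t - (k == l)%:R * (N / (N - 1))) ^+ 2
  = X ^+ 2 + 2 * Z ^+ 2 + Y ^+ 2 - N ^+ 2 * t.
  have Z2 := sqr_ge0 Z; have XY2 := sqr_ge0 (X - Y); nra.
transitivity (\sum_k (x k ^+ 2 * X + 2 * (x k * y k) * Z + y k ^+ 2 * Y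
    + N * t ^+ 2 - (N * t) ^+ 2)).
  apply: eq_bigr => k _.
  transitivity (\sum_l (x k ^+ 2 * x l ^+ 2 + 2 * (x k * y k) * (x l * y l)
    + y k ^+ 2 * y l ^+ 2 + t ^+ 2 + 2 * t * x k * x l + 2 * t * y k * y l
    - (k == l)%:R * (N * t) ^+ 2)).
    apply: eq_bigr => l _; have [<-|_] := eqVneq k l; last by rewrite !mul0r; ring.
    have xyk := xy k; rewrite !mul1r -/t tE.
    have -> : x k * x k + y k * y k = 1 by rewrite -xyk; ring.
    transitivity ((x k ^+ 2 + y k ^+ 2 + t) ^+ 2 - (1 + t) ^+ 2); last by ring.
    by rewrite xyk; ring.
  rewrite sumrB !big_split /= -!mulr_sumr sx sy !mulr0 !addr0.
  rewrite [X in _ - X](bigD1 k) //= eqxx mul1r [X in _ - (_ + X)]big1 ?addr0; last first.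
    by move=> l; rewrite eq_sym => /negbTE ->; rewrite mul0r.
  rewrite sumr_const card_ord -[_ *+ n]mulr_natl -/X -/Y -/Z -/N; ring.
rewrite sumrB !big_split /= -!mulr_suml -!mulr_sumr !sumr_const card_ord.
rewrite -/X -/Y -/Z -[N *+ n]mulr_natl -/N; apply/eqP; rewrite -subr_eq0.
rewrite [X in X == 0](_ : _ = N ^+ 2 * t * (1 + t - N * t)); last by ring.
by rewrite tE subrr mulr0.
Qed.

Lemma pair_tensor_mass U i j : (1 < n)%N -> i != j ->
  (forall i k, U i k * (U i k)^* = n%:R^-1) ->
  (forall i j, \sum_k U i k * (U j k)^* = (i == j)%:R) ->
  n%:R ^+ 2 * (n%:R - 3) / (2 * (n%:R - 1))
    <= \sum_k \sum_l pair_tensor U i j k l ^+ 2.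
Proof.
move=> n1 ij flat orth; have n0 : n%:R != 0 :> R by rewrite pnatr_eq0; lia.
pose z k := U i k * (U j k)^*.
have sz : \sum_k z k = 0 by rewrite orth (negbTE ij).
have zz k : z k * (z k)^* = ((n%:R : R) ^- 2)%:C%C.
  rewrite /z rmorphM /= conjCK mulrACA flat [_^* * _]mulrC flat.
  by rewrite fmorphV rmorphXn rmorph_nat expr2 -invfM.
have sRe : \sum_k complex.Re (z k) = 0 by rewrite -Re_sum sz.
have sIm : \sum_k complex.Im (z k) = 0.
  transitivity (complex.Im (\sum_k z k)); last by rewrite sz.
  by symmetry; apply: (big_morph (@complex.Im R)) => // -[a b] [c d].
have := @sum_sqr_gram_ge (fun k => n%:R * complex.Re (z k))
  (fun k => n%:R * complex.Im (z k)) n1.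
rewrite -!mulr_sumr sRe sIm mulr0.
set S := (X in _ -> _ -> _ -> _ <= X); move=> /(_ _ erefl erefl).
have -> : \sum_k \sum_l pair_tensor U i j k l ^+ 2 = S.
  apply: eq_bigr => k _; apply: eq_bigr => l _; rewrite pair_tensorE //.
  congr ((_ + _ - _) ^+ 2); rewrite /gram.
  have -> : U j l * (U i l)^* = (z l)^* by rewrite /z rmorphM /= conjCK mulrC.
  rewrite -/(z k); case: (z k) (z l) => a b [c d] /=; ring.
apply=> k; have := congr1 (@complex.Re R) (zz k).
case: (z k) => a b /= abE; rewrite !exprMn -mulrDr.
have -> : a ^+ 2 + b ^+ 2 = n%:R ^- 2 by rewrite -abE; ring.
by rewrite mulfV // expf_neq0.
Qed.

Lemma lift_pair_tensor U J (r : nat) i j : (1 < n)%N -> #|J| = r -> i != j ->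
  (forall i k, U i k * (U i k)^* = n%:R^-1) ->
  lift_sum (pair_tensor U i j) J = n%:R ^+ 2
      * complex.Re (col_kernel U J i j * col_kernel U J j i)
    + r%:R ^+ 2 / (n%:R - 1) - r%:R * (n%:R / (n%:R - 1)).
Proof.
move=> n1 hJ ij flat; rewrite /lift_sum /col_kernel mulr_suml Re_sum mulr_sumr.
transitivity (\sum_(k in J) (n%:R ^+ 2 *
  complex.Re (U i k * (U j k)^* * (\sum_(l in J) U j l * (U i l)^*))
  + r%:R / (n%:R - 1) - n%:R / (n%:R - 1) : R)).
  apply: eq_bigr => k kJ; rewrite mulr_sumr Re_sum mulr_sumr.
  under eq_bigr do rewrite pair_tensorE //.
  rewrite sumrB big_split /= sumr_const hJ -[_ *+ r]mulr_natl.
  rewrite [X in _ - X](bigD1 k) //= eqxx mul1r [X in _ - (_ + X)]big1 ?addr0 //.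
  by move=> l /andP[_]; rewrite eq_sym => /negbTE ->; rewrite mul0r.
rewrite sumrB big_split /= !sumr_const hJ.
by rewrite -[(r%:R / _) *+ r]mulr_natl -[(n%:R / _) *+ r]mulr_natl; ring.
Qed.

Lemma col_kernel_diag U J (r : nat) i : #|J| = r ->
  (forall i k, U i k * (U i k)^* = n%:R^-1) ->
  col_kernel U J i i = (r%:R / n%:R : R)%:C%C.
Proof.
move=> hJ flat; rewrite /col_kernel; under eq_bigr do rewrite flat.
by rewrite sumr_const hJ -[_ *+ r]mulr_natl rmorphM /= fmorphV !rmorph_nat.
Qed.

Lemma scaled_Hadamard_flat U : (0 < n)%N ->
  complex_Hadamard ((Num.sqrt (n%:R : R))%:C%C *: U) ->
  forall i k, U i k * (U i k)^* = n%:R^-1.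
Proof.
move=> n_gt0 [+ _] i k => /(_ i k); rewrite mxE normrM => h1.
have n0 : n%:R != 0 :> R[i] by rewrite pnatr_eq0; lia.
apply: (mulfI n0); rewrite mulfV // -normCK.
have := congr1 (fun x => x ^+ 2) h1.
rewrite exprMn expr1n ger0_norm ?ler0c ?sqrtr_ge0 //.
by rewrite -rmorphXn /= sqr_sqrtr ?ler0n // rmorph_nat.
Qed.

End FlatUnitary.

(** * The lower bound *)

Local Open Scope complex_scope.

Theorem corollary5p3 (R : realType) (n : nat) (U : 'M[R[i]]_n)
    (U_unitary : U \is unitarymx)
    (U_Hadamard : complex_Hadamard ((Num.sqrt (n%:R : R))%:C *: U))
    (r : nat) (r_ge2 : (2 <= r)%N) (r_le : (r <= n - 2)%N) :
  minor_discrepancy r U >= (n%:R - 3) / (2 * n%:R).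
Proof.
have n4 : (4 <= n)%N by lia.
have n1 : (1 < n)%N by lia.
have n4R : (4 : R) <= n%:R by rewrite ler_nat.
have rows i j : \sum_k U i k * (U j k)^* = (i == j)%:R.
  have /unitarymxP/matrixP/(_ i j) := U_unitary.
  by rewrite !mxE => <-; apply: eq_bigr => k _; rewrite !mxE.
have cols k l : \sum_i (U i k)^* * U i l = (k == l)%:R.
  have := U_unitary; rewrite -trmxC_unitary => /unitarymxP/matrixP/(_ k l).
  rewrite !mxE => <-.
  by apply: eq_bigr => i _; rewrite !mxE; congr (_ * _); rewrite conjCK.
have flat := scaled_Hadamard_flat (ltnW n1) U_Hadamard.
have rowsT i j : \sum_k U^T i k * (U^T j k)^* = (i == j)%:R.
  by rewrite eq_sym -cols; apply: eq_bigr => k _; rewrite !mxE mulrC.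
have flatT i k : U^T i k * (U^T i k)^* = n%:R^-1 by rewrite !mxE.
pose h := pair_tensor U.
have h_in i j : harmonic (h i j) by exact: pair_tensor_harmonic.
(* Transposing U exchanges the roles of (i, j) and (k, l). *)
have h_out k l : harmonic (fun i j => h i j k l).
  have [s z m] := pair_tensor_harmonic k l n1 flatT rowsT.
  split=> [i j|i|i]; rewrite /h -?(pair_tensor_tr U).
  - exact: s.
  - exact: z.
  by under eq_bigr do rewrite -pair_tensor_tr; exact: m.
(* For i != j, a J i j is |K i j|^2 for the column set J, minus its mean over pairs. *)
pose a (J : {set 'I_n}) i j := (n%:R ^+ 2)^-1 * lift_sum (h i j) J.
have a_harm J : harmonic (a J).
  split=> [i j|i|i]; rewrite /a.
  - congr (_ * _); apply: eq_bigr => k _; apply: eq_bigr => l _.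
    by have [s _ _] := h_out k l; exact: s.
  - rewrite /lift_sum big1 ?mulr0 // => k _; rewrite big1 // => l _.
    by have [_ z _] := h_out k l; exact: z.
  - rewrite -mulr_sumr /lift_sum exchange_big big1 ?mulr0 //= => k _.
    rewrite exchange_big big1 //= => l _.
    by have [_ _ m] := h_out k l; exact: m.
have c0 : 0 < lift_const R n r by exact: lift_const_gt0.
set c := lift_const R n r in c0.
have per_col (J : {set 'I_n}) : #|J| = r ->
  (\sum_i \sum_j a J i j ^+ 2) / (2 * c) <=
  \sum_(I : {set 'I_n} | #|I| == r)
    (ComplexField.Normc.normc (minor r U I J) ^+ 2 - 'C(n, r)%:R^-1) ^+ 2.
  move=> hJ.
  (* The constant kappa collects (1 - r/n)^2, the uniform term and the recentring. *)
  apply: (@sum_sqr_ge_pairs _ _ _ _ _ ((1 - r%:R / n%:R) ^+ 2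
     - ('C(n - 2, r))%:R / ('C(n, r))%:R
     + (n%:R ^+ 2)^-1 * (r%:R ^+ 2 / (n%:R - 1) - r%:R * (n%:R / (n%:R - 1))))) => //.
  move=> i j ij; under eq_bigr do rewrite mulrBr.
  rewrite sumrB -mulr_suml sum_avoiding_const // sum_minors_avoiding //.
  have ReE (t : R) (w : R[i]) :
      complex.Re ((1 - t%:C) * (1 - t%:C) - w) = (1 - t) ^+ 2 - complex.Re w.
    by case: w => u v /=; ring.
  rewrite /a (lift_pair_tensor n1 hJ ij flat) !(col_kernel_diag _ hJ flat) ReE.
  move: ('C(n, r)%:R^-1) => w.
  by field; apply/andP; split; lra.
rewrite /minor_discrepancy exchange_big /=.
apply: (@le_trans _ _ (\sum_(J : {set 'I_n} | #|J| == r)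
   (\sum_i \sum_j a J i j ^+ 2) / (2 * c))); last first.
  by apply: ler_sum => J /eqP; exact: per_col.
have -> : \sum_(J : {set 'I_n} | #|J| == r) (\sum_i \sum_j a J i j ^+ 2) / (2 * c)
   = (n%:R ^+ 4)^-1 * \sum_i \sum_j \sum_k \sum_l h i j k l ^+ 2.
  rewrite -mulr_suml exchange_big mulr_sumr mulr_suml; apply: eq_bigr => i _.
  rewrite exchange_big mulr_sumr mulr_suml; apply: eq_bigr => j _.
  under eq_bigr do rewrite exprMn.
  rewrite -mulr_sumr lift_sum_sqr // -/c; field; apply/andP; split; lra.
pose B : R := n%:R ^+ 2 * (n%:R - 3) / (2 * (n%:R - 1)).
have -> : (n%:R - 3) / (2 * n%:R) = (n%:R ^+ 4)^-1 * (n%:R * ((n%:R - 1) * B)).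
  by rewrite /B; field; apply/andP; split; lra.
rewrite ler_wpM2l ?invr_ge0 ?exprn_ge0 ?ler0n //.
rewrite mulr_natl -[X in _ *+ X]card_ord -sumr_const; apply: ler_sum => i _.
rewrite (bigD1 i) //= ler_wpDl //.
  by apply: sumr_ge0 => k _; apply: sumr_ge0 => l _; exact: sqr_ge0.
have -> : (n%:R - 1) * B = \sum_(j | j != i) B.
  have -> : n%:R - 1 = n.-1%:R :> R by rewrite -subn1 natrB //; lia.
  by rewrite sumr_const cardC1 card_ord mulr_natl.
by apply: ler_sum => j ij; apply: pair_tensor_mass; rewrite // eq_sym.
Qed.
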